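(* Let $\Gamma$ be a trivalent graph embedded in $\mathbb{S}^2$, and consider the surface with defects $(\mathbb{S}^2,\Gamma)$ as a morphism $\emptyset\to\emptyset$ in $\mathrm{Bord}_2^{\mathrm{def,cw}}(\mathcal{D}_+^{\mathbf 3})$. Then the functor $\chi^{cw}$ sends $(\mathbb{S}^2,\Gamma)$ to the linear map $$\chi^{cw}(\mathbb{S}^2,\Gamma):\mathbb{C}\to\mathbb{C},\qquad \lambda\mapsto \#\mathrm{Tait}(\Gamma)\,\lambda .$$ In other words, the number $\chi^{cw}(\mathbb{S}^2,\Gamma)(1)$ is the number of Tait-colorings of the planar trivalent graph $\Gamma$.
   Context: **Tait-colorings.** A Tait-coloring ($3$-edge coloring) of a trivalent graph $\Gamma$ is an assignment of an element of $\{a,b,c\}$ to each edge such that at every vertex the three incident (half-)edges receive three different elements. $\#\mathrm{Tait}(\Gamma)$ is the number of such colorings. **The category $\mathrm{Bord}_2^{\mathrm{def,cw}}(\mathcal{D}_+^{\mathbf 3})$.** Objects are finite disjoint unions of oriented circles with finitely many marked points (all carrying the same label), each circle having a distinguished unmarked point, and equipped with a cell decomposition in which each marked point lies in the interior of a $1$-cell and each $1$-cell contains at most one marked point. A morphism $U\to V$ is a pair $(\Sigma,\Gamma)$ (up to boundary-preserving isomorphism), where $\Sigma$ is a compact oriented surface with $\partial\Sigma=(-U)\sqcup V$ and $\Gamma\subset\Sigma$ is an embedded undirected trivalent graph: its vertices (all of valency $3$) lie in the interior, its edges are transverse to $\partial\Sigma$ and meet $\partial\Sigma$ exactly in the marked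 points. The surface $\Sigma$ carries a PLCW decomposition (a generalized cell decomposition in the sense of Kirillov; $C_k(\Sigma)$ is the set of $k$-cells) extending that of the boundary, such that $\Gamma$ misses the $0$-cells, each $1$-cell meets $\Gamma$ in at most one point, and each $2$-cell $P$ (a polygon, called a basic-gon) is of one of three types: (I) $P\cap\Gamma=\emptyset$; (II) $P\cap\Gamma$ is one arc crossing two sides of $P$; (III) $P$ has exactly three sides, and $P\cap\Gamma$ is a star with one trivalent vertex and three legs, each side of $P$ being crossed by exactly one leg. **The functor $\chi^{cw}$.** Let $X=\mathbb{C}\langle a,b,c\rangle$, identified with $X^*$ via the symmetric bilinear form for which $a,b,c$ are orthonormal. Let $\mu:X^{\otimes 3}\to\mathbb{C}$ be the linear map with $\mu(x\otimes y\otimes z)=1$ if the basis vectors $x,y,z\in\{a,b,c\}$ are all different, and $0$ otherwise. To a $1$-cell $e$ of an object assign $R_e=X$ if $e$ contains a marked point and $R_e=\mathbb{C}$ otherwise. For an object $U$, $\chi^{cw}(U)=\bigotimes_{e\in C_1(U)}R_e$ (so a circle with $n$ marked points is sent to $X^{\otimes n}$, and $\emptyset$ to $\mathbb{C}$). To each side $e$ of each $2$-cell $P$ assign $Q_{(P,e)}=X$ if $e$ meets $\Gamma$ and $Q_{(P,e)}=\mathbb{C}$ otherwise. For $(\Sigma,\Gamma):U\to V$ let $Q(\Sigma)$ be the tensor product of all $Q_{(P,e)}$ with $e$ not on the in-boundary $U$. The map $\chi^{cw}(\Sigma,\Gamma)$ is the composite $$\chi^{cw}(U)\xrightarrow{\mathbf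 1\otimes\mathscr{P}(\Sigma)}\chi^{cw}(U)\otimes Q(\Sigma)\otimes\chi^{cw}(V)\xrightarrow{\mathscr{E}(\Sigma)\otimes\mathbf 1}\chi^{cw}(V).$$ Here $\mathscr{P}(\Sigma)=\bigotimes_{e\notin U}\mathscr{P}_e$; for an interior $1$-cell $e$, $\mathscr{P}_e$ maps $\mathbb{C}$ to the tensor product of the two spaces $Q$ attached to the two sides equal to $e$, and for $e$ on the out-boundary $V$, $\mathscr{P}_e:\mathbb{C}\to Q_{(P,e)}\otimes R_e$; in each case $\mathscr{P}_e(\lambda)=\lambda(a\otimes a+b\otimes b+c\otimes c)$ if $e$ meets $\Gamma$, and $\mathscr{P}_e(\lambda)=\lambda(1\otimes 1)$ otherwise. The map $\mathscr{E}(\Sigma)=\bigotimes_{P\in C_2(\Sigma)}\mathscr{E}_P$ (identifying $\chi^{cw}(U)$ with the tensor product of the $Q_{(P,e)}$ for $e$ on $U$), where $\mathscr{E}_P:\bigotimes_{e\subset\partial P}Q_{(P,e)}\to\mathbb{C}$ is: multiplication of scalars for type I; the product of the scalars with the bilinear pairing of the two $X$-factors for type II; $\mu$ for type III. (The resulting symmetric monoidal functor to finite-dimensional complex vector spaces does not depend on the choice of PLCW decomposition in the interior.) *)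

(* Defs.v *)
From HB Require Import structures.
From mathcomp Require Import all_boot all_order all_algebra.
From mathcomp Require Import all_classical all_reals all_analysis.
From mathcomp Require Import complex.
Set Implicit Arguments.
Unset Strict Implicit.
Unset Printing Implicit Defensive.
Import Order.TTheory GRing.Theory Num.Theory.
Import numFieldNormedType.Exports.
Local Open Scope classical_set_scope.
Local Open Scope ring_scope.

(* The three labels a, b, c. *)
Definition color : finType := 'I_3.

(* An edge [e] has two ends, (e, false) and (e, true), so that a half-edge is
   a pair [(e, b)]; loops and multiple edges are allowed.  [ends e b = None]
   means that this end is not at a vertex: it is a point of the boundary of
   the surface, or [e] is a circle without vertices (see [is_embedding]). *)
Record trivalent_graph := TrivalentGraph {
  vertex : finType;
  edge : finType;
  ends : edge -> bool -> option vertex;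
  trivalent : forall v : vertex,
    #|[pred h : edge * bool | ends h.1 h.2 == Some v]| = 3%N
}.

Definition is_tait (G : trivalent_graph) (c : {ffun edge G -> color}) : bool :=
  [forall v : vertex G, forall h : edge G * bool, forall h' : edge G * bool,
    [&& ends h.1 h.2 == Some v, ends h'.1 h'.2 == Some v & h != h']
      ==> (c h.1 != c h'.1)].

Definition tait_number (G : trivalent_graph) : nat :=
  #|[pred c : {ffun edge G -> color} | is_tait c]|.

Section Topology.
Variables (R : realType) (T : topologicalType).

Definition sphere : set 'rV[R]_3 := [set x | \sum_i x ord0 i ^+ 2 = 1].

Definition disc : set (R * R) := [set z | z.1 ^+ 2 + z.2 ^+ 2 <= 1].
Definition open_disc : set (R * R) := [set z | z.1 ^+ 2 + z.2 ^+ 2 < 1].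

(* The unit disc as an n-gon, n >= 1: its boundary circle is cut into n equal
   sides, [fun t => side_pt n i t] running through the i-th one for
   0 <= t <= 1. *)
Definition side_pt (n i : nat) (t : R) : R * R :=
  (cos (2 * pi * ((i%:R + t) / n%:R)), sin (2 * pi * ((i%:R + t) / n%:R))).
Definition open_side (n i : nat) : set (R * R) :=
  side_pt n i @` `]0, 1[.

(* Positions of the vertices and parametrizations of the edges by [0, 1]. *)
Record drawing (G : trivalent_graph) := Drawing {
  vpos : vertex G -> T;
  epath : edge G -> R -> T
}.

Definition drawing_set (G : trivalent_graph) (D : drawing G) : set T :=
  range (vpos D) `|` \bigcup_(e in [set: edge G]) (epath D e @` `[0, 1]).

(* [D] is an embedding of [G] in the surface [S] with boundary [bd].  Two
   parameters give the same point only if that point is a vertex, or if they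
   are the two ends of a circle component. *)
Record is_embedding (S bd : set T) (G : trivalent_graph) (D : drawing G) :
    Prop := IsEmbedding {
  emb_sub : drawing_set D `<=` S;
  emb_cont : forall e, {within `[0, 1], continuous (epath D e)};
  emb_vertex_inj : injective (vpos D);
  emb_vertex_int : forall v, ~ bd (vpos D v);
  emb_end : forall e b v, ends e b = Some v -> epath D e b%:R = vpos D v;
  emb_vertex_end : forall e (t : R) v, t \in `[0, 1] -> epath D e t = vpos D v ->
    exists2 b : bool, t = b%:R & ends e b = Some v;
  emb_free_end : forall e b, ends e b = None ->
    (bd (epath D e b%:R) <-> epath D e 0 <> epath D e 1);
  emb_edge_int : forall e (t : R), t \in `]0, 1[ -> ~ bd (epath D e t);
  emb_inj : forall e e' (t t' : R), t \in `[0, 1] -> t' \in `[0, 1] ->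
    epath D e t = epath D e' t' ->
    [\/ e = e' /\ t = t',
        exists v, epath D e t = vpos D v
      | e = e' /\ exists b : bool, t = b%:R /\ t' = (~~ b)%:R]
}.

(* The data of a two-dimensional PLCW decomposition: the 0-cells; the 1-cells
   with their characteristic maps, defined on [0, 1]; the 2-cells with their
   numbers of sides, characteristic maps, defined on [disc] seen as a polygon,
   and the 1-cell onto which each side is glued; the 1-cells of the
   in-boundary U and of the out-boundary V. *)
Record cells := Cells {
  cell0 : finType;
  cell1 : finType;
  cell2 : finType;
  char0 : cell0 -> T;
  char1 : cell1 -> R -> T;
  char2 : cell2 -> R * R -> T;
  nsides : cell2 -> nat;
  glued_to : forall P : cell2, 'I_(nsides P) -> cell1;
  inb : pred cell1;
  outb : pred cell1
}.

(* The sides (P, e) of the 2-cells; the two sides of P that are glued onto the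
   same 1-cell are distinct. *)
Definition side (K : cells) : finType := {P : cell2 K & 'I_(nsides P)}.
Definition side_cell (K : cells) (s : side K) : cell1 K := glued_to (tagged s).

Definition open_cell (K : cells) (c : cell0 K + (cell1 K + cell2 K)) : set T :=
  match c with
  | inl v => [set char0 v]
  | inr (inl e) => char1 e @` `]0, 1[
  | inr (inr P) => char2 P @` open_disc
  end.

Definition closed_cells1 (K : cells) (A : pred (cell1 K)) : set T :=
  \bigcup_(e in [set e | A e]) (char1 e @` `[0, 1]).

Definition boundary (K : cells) : set T :=
  closed_cells1 (fun e : cell1 K => inb e || outb e).

(* [K] is a PLCW decomposition of the surface [S], with boundary (-U) + V: the
   boundary 1-cells are those which are a side of only one polygon, counted
   once.  The characteristic map of a 2-cell is injective on the interior and
   on each open side, but may identify points of the boundary of the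
   polygon. *)
Record is_plcw (S : set T) (K : cells) : Prop := IsPLCW {
  plcw_cover : \bigcup_c @open_cell K c = S;
  plcw_disjoint : trivIset setT (@open_cell K);
  plcw_cont1 : forall e : cell1 K, {within `[0, 1], continuous (char1 e)};
  plcw_inj1 : forall e : cell1 K, {in `]0, 1[ &, injective (char1 e)};
  plcw_end1 : forall (e : cell1 K) (b : bool), exists v : cell0 K,
    char1 e b%:R = char0 v;
  plcw_cont2 : forall P : cell2 K, {within disc, continuous (char2 P)};
  plcw_inj2 : forall P : cell2 K, {in open_disc &, injective (char2 P)};
  plcw_nsides : forall P : cell2 K, (0 < nsides P)%N;
  plcw_corner : forall (P : cell2 K) (i : 'I_(nsides P)),
    exists v : cell0 K, char2 P (side_pt (nsides P) i 0) = char0 v;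
  plcw_side_inj : forall (P : cell2 K) (i : 'I_(nsides P)),
    {in open_side (nsides P) i &, injective (char2 P)};
  plcw_side : forall (P : cell2 K) (i : 'I_(nsides P)),
    char2 P @` open_side (nsides P) i = char1 (glued_to i) @` `]0, 1[;
  plcw_side_card : forall e : cell1 K,
    #|[pred s : side K | side_cell s == e]|
      = if inb e || outb e then 1%N else 2%N;
  plcw_in_out : closed_cells1 (@inb K) `&` closed_cells1 (@outb K) = set0
}.

Section Basic_gons.
Variables (G : trivalent_graph) (D : drawing G) (K : cells).

(* Intersections with a 2-cell are taken in the polygon, before its sides are
   glued. *)
Definition trace (P : cell2 K) : set (R * R) :=
  [set z | disc z /\ drawing_set D (char2 P z)].

Definition trace_vertex (P : cell2 K) : set (R * R) :=
  [set z | disc z /\ range (vpos D) (char2 P z)].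

Definition type_I (P : cell2 K) : Prop := trace P = set0.

Definition type_II (P : cell2 K) : Prop :=
  exists (i j : 'I_(nsides P)) (arc : R -> R * R),
  [/\ i != j,
      {within `[0, 1], continuous arc} /\ {in `[0, 1] &, injective arc},
      [/\ open_side (nsides P) i (arc 0), open_side (nsides P) j (arc 1)
        & forall t : R, t \in `]0, 1[ -> open_disc (arc t)],
      trace P = arc @` `[0, 1]
    & trace_vertex P = set0].

Definition type_III (P : cell2 K) : Prop :=
  nsides P = 3%N /\
  exists (x : R * R) (leg : 'I_(nsides P) -> R -> R * R),
  [/\ forall i, [/\ {within `[0, 1], continuous (leg i)},
        {in `[0, 1] &, injective (leg i)}, leg i 0 = x,
        forall t : R, t \in `[0, 1[ -> open_disc (leg i t)
      & open_side (nsides P) i (leg i 1)],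
      forall i j (t t' : R), t \in `[0, 1] -> t' \in `[0, 1] ->
        leg i t = leg j t' -> i = j \/ t = 0,
      trace P = \bigcup_(i in [set: 'I_(nsides P)]) (leg i @` `[0, 1])
    & trace_vertex P = [set x]].

(* (S, D) with the decomposition [K] is a morphism of the bordism category
   from its in-boundary to its out-boundary; S is meant to be a compact
   surface.  Neither its orientation nor the distinguished points of the
   boundary circles enter chi^cw, and they are not recorded. *)
Record is_bordism (S : set T) : Prop := IsBordism {
  bord_plcw : is_plcw S K;
  bord_emb : is_embedding S (boundary K) D;
  bord_miss : forall v : cell0 K, ~ drawing_set D (char0 v);
  bord_cross : forall (e : cell1 K) (t t' : R),
    t \in `]0, 1[ -> t' \in `]0, 1[ ->
    drawing_set D (char1 e t) -> drawing_set D (char1 e t') -> t = t';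
  bord_gon : forall P : cell2 K, [\/ type_I P, type_II P | type_III P]
}.

Definition crossed (e : cell1 K) : bool :=
  `[< exists2 t, t \in `]0, 1[ & drawing_set D (char1 e t) >].

End Basic_gons.
End Topology.
Arguments sphere R : clear implicits.

(* Tensor products of the spaces X = C<a, b, c> and C.  Let Y_i be X if [m i]
   and C otherwise.  The distinguished basis of Y_i consists of [Some x], for
   x in {a, b, c}, if Y_i = X, and of the single vector [None] (the number 1)
   if Y_i = C.  The tensor product of the Y_i, i in I, has as basis the
   families of such basis vectors, and is represented by the coordinates in
   this basis; the tensor product of tens m1 and tens m2 by coordinates
   indexed by pairs of families. *)
Definition basis (I : finType) (m : pred I) : finType :=
  {f : {ffun I -> option color} | [forall i, isSome (f i) == m i]}.

Section Functor.
Variables (R : realType) (T : topologicalType).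

Definition tens (I : finType) (m : pred I) : Type :=
  {ffun basis m -> R[i]^o}.

(* For empty I, this is the identification of C with the empty tensor product. *)
Definition tens_scalar (I : finType) (m : pred I) (z : R[i]) : tens m :=
  [ffun=> z].

(* The value on basis vectors of the bilinear pairing on X, and of mu. *)
Definition pairing (x y : color) : R[i] := (x == y)%:R.
Definition mu (x y z : color) : R[i] := (uniq [:: x; y; z])%:R.

Variables (G : trivalent_graph) (D : drawing R T G) (K : cells R T).

Definition in_cell : finType := {e : cell1 K | inb e}.
Definition out_cell : finType := {e : cell1 K | outb e}.
Definition Q_side : finType := {s : side K | ~~ inb (side_cell s)}.

Definition in_crossed : pred in_cell := fun e => crossed D (val e).
Definition out_crossed : pred out_cell := fun e => crossed D (val e).
Definition Q_crossed : pred Q_side := fun s => crossed D (side_cell (val s)).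

(* chi^cw(U) and chi^cw(V) *)
Definition chi_in : Type := tens in_crossed.
Definition chi_out : Type := tens out_crossed.

(* The coordinates of P_e(1), which is the sum over the basis vectors x of the
   space attached to e (X or C) of the tensor product of one copy of x for
   each Q_(P, e) and, if e is on the out-boundary, of one copy of x for R_e. *)
Definition copairing (e : cell1 K) (q : basis Q_crossed)
    (v : basis out_crossed) : R[i] :=
  \sum_(x : option color | isSome x == crossed D e)
    (\prod_(s : Q_side | side_cell (val s) == e) (val q s == x)%:R) *
    (\prod_(o : out_cell | val o == e) (val v o == x)%:R).

Definition P_Sigma (q : basis Q_crossed) (v : basis out_crossed) : R[i] :=
  \prod_(e : cell1 K | ~~ inb e) copairing e q v.

(* E_P on basis vectors.  [pmap] drops the factors C: what remains is the
   basis vector of the tensor product of the factors X, of which there are 0,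
   2 or 3 according to the type of P. *)
Definition eval_gon (P : cell2 K) (f : 'I_(nsides P) -> option color) : R[i] :=
  match pmap f (enum 'I_(nsides P)) with
  | [::] => 1
  | [:: x; y] => pairing x y
  | [:: x; y; z] => mu x y z
  | _ => 0
  end.

(* The basis vector of the tensor product of all the Q_(P, e) given by basis
   vectors of chi^cw(U) and of Q(Sigma). *)
Definition side_label (u : basis in_crossed) (q : basis Q_crossed)
    (s : side K) : option color :=
  if insub (side_cell s) is Some e then val u e
  else if insub s is Some s' then val q s' else None.

Definition E_Sigma (u : basis in_crossed) (q : basis Q_crossed) : R[i] :=
  \prod_(P : cell2 K)
    eval_gon (fun i : 'I_(nsides P) => side_label u q (Tagged _ i)).

Definition middle : Type :=
  {ffun basis in_crossed * basis Q_crossed * basis out_crossed -> R[i]^o}.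

Definition id_tens_P (w : chi_in) : middle :=
  [ffun b => w b.1.1 * P_Sigma b.1.2 b.2].

Definition E_tens_id (w : middle) : chi_out :=
  [ffun v => \sum_(b : basis in_crossed * basis Q_crossed)
               E_Sigma b.1 b.2 * w (b.1, b.2, v)].

Definition chi_cw (w : chi_in) : chi_out := E_tens_id (id_tens_P w).

Lemma chi_cw_linear (a : R[i]) (w w' : chi_in) (v : basis out_crossed) :
  chi_cw [ffun u => a * w u + w' u] v = a * chi_cw w v + chi_cw w' v.
Proof.
rewrite !ffunE mulr_sumr -big_split /=; apply: eq_bigr => b _.
by rewrite !ffunE /= mulrDl mulrDr !mulrA (mulrC a).
Qed.

End Functor.

(* Main.v *)
(** In coordinates, chi^cw of the closed surface is the number of labellings of
    the crossed 1-cells by colors such that the two labels on a polygon of type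
    II agree and the three labels on a polygon of type III are distinct: the
    copairings force the labels of the two sides glued to a 1-cell to agree.
    A Tait coloring labels each crossed 1-cell by the color of the edge of the
    graph crossing it there.  This is a bijection.  The arc of a polygon of type
    II stays in a single edge, and the three legs of a polygon of type III leave
    its vertex along the three different half-edges, so Tait colorings give
    admissible labellings.  Conversely the label of an admissible labelling is
    locally constant along each edge, away from the vertices, so that it defines
    a coloring of the edges.  All these facts are instances of one principle: a
    connected set covered by finitely many closed sets that are disjoint on it
    lies in one of them. *)

Require Import Defs.
From mathcomp Require Import all_boot all_order all_algebra.
From mathcomp Require Import all_classical all_reals all_analysis.
From mathcomp Require Import complex lra.
Set Implicit Arguments.
Unset Strict Implicit.
Unset Printing Implicit Defensive.
Import Order.TTheory GRing.Theory Num.Theory.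
Import numFieldNormedType.Exports.
Local Open Scope classical_set_scope.
Local Open Scope ring_scope.

(** * Closed covers of connected sets, and the polygon *)

Lemma within_continuous_within_comp (U V W : topologicalType) (A : set U)
    (B : set V) (f : U -> V) (g : V -> W) :
  f @` A `<=` B -> {within A, continuous f} -> {within B, continuous g} ->
  {within A, continuous (g \o f)}.
Proof.
move=> fAB /subspace_continuousP cf /subspace_continuousP cg.
apply/subspace_continuousP => x Ax X /= nX.
have := cg _ (fAB _ (ex_intro2 _ _ x Ax erefl)) X nX.
rewrite /= nbhs_simpl /= => nB; have := cf x Ax _ nB; rewrite /= !nbhs_simpl /=.
rewrite /within /=; apply: filterS => y + Ay; apply => //.
by apply: fAB; exists y.
Qed.

(** Because [I] is finite, the union of the sets [C k] with [k != i] is closed. On [A] its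
    complement agrees with [C i], so [C i] is both open and closed in [A], and it contains [x];
    hence it contains all of [A]. *)
Lemma connected_label (T : topologicalType) (I : finType) (A : set T)
    (C : I -> set T) (x y : T) (i j : I) :
  connected A -> (forall k, closed (C k)) ->
  (forall z, A z -> exists k, C k z) ->
  (forall z k l, A z -> C k z -> C l z -> k = l) ->
  A x -> A y -> C i x -> C j y -> i = j.
Proof.
move=> cA cC cov dis Ax Ay Cx Cy.
have eqA : A `&` C i = A.
  apply: cA; first by exists x.
    exists (~` \bigcup_(k in [set k | k != i]) C k).
      rewrite openC; apply: closed_bigcup => [|k _]; last exact: cC.
      exact: finite_finset.
    apply/seteqP; split=> z [Az Cz]; split=> //.
      by case=> k /= /eqP + Ckz; apply; exact: (dis z).
    have [k Ckz] := cov _ Az; case: (eqVneq k i) => [<- //|ki].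
    by case: Cz; exists k.
  by exists (C i).
by move: Ay; rewrite -eqA => -[Ay Ciy]; exact: (dis y).
Qed.

Lemma path_label (R : realType) (T : topologicalType) (I : finType)
    (g : R -> T) (a b : R) (C : I -> set T) (s t : R) (i j : I) :
  {within `[a, b], continuous g} -> (forall k, closed (C k)) ->
  (forall u, u \in `[a, b] -> exists k, C k (g u)) ->
  (forall u k l, u \in `[a, b] -> C k (g u) -> C l (g u) -> k = l) ->
  s \in `[a, b] -> t \in `[a, b] -> C i (g s) -> C j (g t) -> i = j.
Proof.
move=> cg cC cov dis sab tab Cs Ct.
apply: (@connected_label T I (g @` `[a, b]) C (g s) (g t)) => //.
- by apply: connected_continuous_connected => //; exact: segment_connected.
- by move=> _ [u uab <-]; exact: cov.
- by move=> _ k l [u uab <-]; exact: dis.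
Qed.

Lemma closed_path (R : realType) (T : topologicalType) (g : R -> T) (a b : R) :
  hausdorff_space T -> {within `[a, b], continuous g} -> closed (g @` `[a, b]).
Proof.
move=> hT cg; apply: compact_closed => //.
by apply: continuous_compact => //; exact: segment_compact.
Qed.

(* cos (a - b) = 1 with |a - b| < 2 pi. *)
Lemma cos_sin_inj (R : realType) (a b : R) : `|a - b| < 2 * pi ->
  cos a = cos b -> sin a = sin b -> a = b.
Proof.
move=> ab ca sa.
(* Halving turns cos (a - b) = 1 into sin h = 0, and sin vanishes only at 0 strictly between -pi and
   pi. *)
pose h := (a - b) / 2.
have : cos (h *+ 2) = 1.
  have -> : h *+ 2 = a - b by rewrite /h -mulr_natr mulfVK.
  by rewrite cosB ca sa -!expr2 cos2Dsin2.
rewrite cos_mulr2n cos2sin2 => /eqP.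
have -> : ((1 - sin h ^+ 2) *+ 2 - 1 == 1 :> R) = (sin h ^+ 2 == 0).
  by apply/eqP/eqP => ?; lra.
rewrite sqrf_eq0 => /eqP sh.
have hpi : `|h| < pi.
  by rewrite /h normrM (@ger0_norm _ 2^-1) // ltr_pdivrMr // mulrC.
have [h0|h0|h0] := ltgtP h 0; last first.
- by apply/eqP; rewrite -subr_eq0; apply/eqP; rewrite /h in h0; lra.
- have := @sin_gt0_pi R h; rewrite h0 sh ltxx /=.
  by rewrite (le_lt_trans (ler_norm _) hpi) => /(_ isT).
- have := @sin_gt0_pi R (- h); rewrite oppr_gt0 h0 sinN sh oppr0 ltxx /=.
  by rewrite (le_lt_trans _ hpi) ?ler_normr ?lexx ?orbT // => /(_ isT).
Qed.

Lemma open_side_circle (R : realType) (n i : nat) (z : R * R) :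
  open_side n i z -> z.1 ^+ 2 + z.2 ^+ 2 = 1.
Proof. by case=> t _ <-; rewrite /= cos2Dsin2. Qed.

Lemma open_side_disc (R : realType) (n i : nat) (z : R * R) :
  open_side n i z -> disc z.
Proof. by rewrite /disc /= => /open_side_circle ->. Qed.

Lemma open_sideN (R : realType) (n i : nat) (z : R * R) :
  open_side n i z -> ~ open_disc z.
Proof. by rewrite /open_disc /= => /open_side_circle ->; rewrite ltxx. Qed.

Lemma open_disc_disc (R : realType) (z : R * R) : open_disc z -> disc z.
Proof. by rewrite /disc /open_disc /= => /ltW. Qed.

(** The angles of points of open sides lie strictly between 0 and 2 pi, so the point determines its
    angle, hence the value [i + s] with [s] strictly between 0 and 1, hence [i]. *)
Lemma open_side_inj (R : realType) (n : nat) (i j : 'I_n) (z : R * R) :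
  open_side n i z -> open_side n j z -> i = j.
Proof.
case=> s /=; rewrite in_itv /= => /andP[s0 s1] <-.
case=> t /=; rewrite in_itv /= => /andP[t0 t1] [ec es].
have n0 : 0 < n%:R :> R by rewrite ltr0n (leq_ltn_trans _ (ltn_ord i)).
have bnd (k : 'I_n) (u : R) : 0 < u -> u < 1 -> 0 < (k%:R + u) / n%:R < 1.
  move=> u0 u1; have k0 : 0 <= k%:R :> R by [].
  rewrite divr_gt0 ?ltr_pdivrMr ?mul1r ?ltr_wpDl //=.
  apply: (@lt_le_trans _ _ (k.+1%:R)); last by rewrite ler_nat.
  by rewrite -natr1 ltrD2l.
have /andP[i0 i1] := bnd i s s0 s1; have /andP[j0 j1] := bnd j t t0 t1.
have : 2 * pi * ((j%:R + t) / n%:R) = 2 * pi * ((i%:R + s) / n%:R) :> R.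
  apply: cos_sin_inj => //.
  rewrite -mulrBr normrM gtr0_norm ?mulr_gt0 ?pi_gt0 //.
  rewrite gtr_pMr ?mulr_gt0 ?pi_gt0 //.
  move: i0 i1 j0 j1; move: (_ / _) (_ / _) => x y x0 x1 y0 y1.
  by rewrite ltr_norml; apply/andP; split; lra.
have p0 : 2 * pi != 0 :> R by rewrite mulf_neq0 ?gt_eqF ?pi_gt0.
move/(mulfI p0)/divIf; rewrite gt_eqF // => /(_ isT) e.
apply/val_inj/eqP; rewrite /= eqn_leq.
apply/andP; split; rewrite -ltnS -(ltr_nat R) -natr1.
  by move: e; move: (i%:R : R) (j%:R : R) => x y e; lra.
by move: e; move: (i%:R : R) (j%:R : R) => x y e; lra.
Qed.

Lemma within_continuous_subitv (R : realType) (T : topologicalType)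
    (g : R -> T) (a b c d : R) : a <= c -> d <= b ->
  {within `[a, b], continuous g} -> {within `[c, d], continuous g}.
Proof.
move=> ac db; apply: continuous_subspaceW => t /=.
rewrite !in_itv /= => /andP[ct td].
by rewrite (le_trans ac ct) (le_trans td db).
Qed.

(* [lra] fails in the presence of an equation in a type without order. *)
Ltac order_lra :=
  repeat match goal with
  | H : @eq (Topological.sort _) _ _ |- _ => clear H
  | H : @eq (option _) _ _ |- _ => clear H
  end; lra.

(** * Edges and 1-cells *)

Section ClosedBordism.
Variables (R : realType) (T : topologicalType) (S : set T).
Variables (G : trivalent_graph) (D : drawing R T G) (K : cells R T).
Hypothesis hausT : hausdorff_space T.
Hypothesis hbord : is_bordism D K S.
Hypothesis hin : forall e : cell1 K, ~~ inb e.
Hypothesis hout : forall e : cell1 K, ~~ outb e.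

Let plcw : is_plcw S K := bord_plcw hbord.
Let emb : is_embedding S (boundary K) D := bord_emb hbord.

Definition is_vertex (p : T) : Prop := range (vpos D) p.
Definition edge_set (e : edge G) : set T := epath D e @` `[0, 1].
Definition crosses (k : cell1 K) (e : edge G) : Prop :=
  exists2 s : R, s \in `]0, 1[ & edge_set e (char1 k s).

Definition open1 (k : cell1 K) : set T := @open_cell R T K (inr (inl k)).
Definition open2 (P : cell2 K) : set T := @open_cell R T K (inr (inr P)).

Lemma open_cell_inj (c c' : cell0 K + (cell1 K + cell2 K)) (p : T) :
  open_cell c p -> open_cell c' p -> c = c'.
Proof. by move=> cp cp'; apply: (plcw_disjoint plcw) => //; exists p. Qed.

(** The shape of the drawing is known only inside polygons, so points of a 1-cell are studied by
    lifting them to a side of some polygon. *)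
Lemma side_exists (k : cell1 K) :
  exists (P : cell2 K) (i : 'I_(nsides P)), glued_to i = k.
Proof.
have := plcw_side_card plcw k.
rewrite (negbTE (hin k)) (negbTE (hout k)) /= => c2.
have /card_gt0P[[P i] /eqP h] : (0 < #|[pred s : side K | side_cell s == k]|)%N.
  by rewrite c2.
by exists P, i.
Qed.

Lemma side_image (P : cell2 K) (i : 'I_(nsides P)) (z : R * R) :
  open_side (nsides P) i z -> open1 (glued_to i) (char2 P z).
Proof. by move=> zi; rewrite /open1 /open_cell -(plcw_side plcw); exists z. Qed.

Lemma side_lift (P : cell2 K) (i : 'I_(nsides P)) (p : T) :
  open1 (glued_to i) p ->
  exists2 z, open_side (nsides P) i z & char2 P z = p.
Proof. by rewrite /open1 /open_cell -(plcw_side plcw). Qed.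

Lemma edge_set_drawing e p : edge_set e p -> drawing_set D p.
Proof. by move=> ep; right; exists e. Qed.

Lemma vertex_drawing p : is_vertex p -> drawing_set D p.
Proof. by left. Qed.

Lemma drawing_edge p : drawing_set D p -> ~ is_vertex p ->
  exists e, edge_set e p.
Proof. by case=> [//|[e _ ep] _]; exists e. Qed.

Lemma edge_set_inj e e' p : ~ is_vertex p -> edge_set e p -> edge_set e' p ->
  e = e'.
Proof.
move=> np ep; case: ep np => t t01 <- np [t' t01' /esym tt'].
have [[]//|[v vt]|[]//] := emb_inj emb t01 t01' tt'.
by case: np; exists v => //; rewrite vt.
Qed.

Lemma edge_set_closed e : closed (edge_set e).
Proof. by apply: closed_path => //; exact: (emb_cont emb). Qed.

(** Away from the vertices the edges are disjoint closed sets, so a path in the drawing that avoids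
    the vertices cannot change edge. *)
Lemma path_edge (g : R -> T) (a b s t : R) e e' :
  {within `[a, b], continuous g} ->
  (forall u, u \in `[a, b] -> drawing_set D (g u) /\ ~ is_vertex (g u)) ->
  s \in `[a, b] -> t \in `[a, b] ->
  edge_set e (g s) -> edge_set e' (g t) -> e = e'.
Proof.
move=> cg gD; apply: path_label => //.
- exact: edge_set_closed.
- by move=> u /gD[? ?]; exact: drawing_edge.
- by move=> u k l /gD[_ ?]; exact: edge_set_inj.
Qed.

(** Only a polygon of type III contains a vertex, and there it is the starting point of the legs,
    which lies in the open disc and not on a side. *)
Lemma cell1_not_vertex k p : open1 k p -> ~ is_vertex p.
Proof.
have [P [i <-]] := side_exists k.
move=> /side_lift[z zi <-] vz; have dz := open_side_disc zi.
case: (bord_gon hbord P) => [hI|[i' [j [arc [_ _ _ _ t0]]]]|].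
- have : trace D P z by split=> //; exact: vertex_drawing.
  by rewrite hI.
- have : trace_vertex D P z by [].
  by rewrite t0.
- case=> _ [x [leg [hleg _ _ tx]]].
  have : trace_vertex D P z by [].
  rewrite tx /= => zx; have [_ _ x0 lo _] := hleg i.
  apply: (open_sideN zi); rewrite zx -x0; apply: lo.
  by rewrite in_itv /= lexx ltr01.
Qed.

Lemma crosses_inj k e e' : crosses k e -> crosses k e' -> e = e'.
Proof.
move=> [s s01 es] [s' s01' es'].
have ss' :=
  bord_cross hbord s01 s01' (edge_set_drawing es) (edge_set_drawing es').
subst s'; apply: edge_set_inj es es'.
by apply: (@cell1_not_vertex k); exists s.
Qed.

Lemma crossesP k p e : open1 k p -> edge_set e p -> crosses k e.
Proof. by move=> [s s01 <-] ep; exists s. Qed.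

Lemma crossedP k : crossed D k <-> exists e, crosses k e.
Proof.
split=> [/asboolP[s s01 ds]|[e [s s01 es]]].
  have [|e es] := drawing_edge ds.
    by apply: (@cell1_not_vertex k); exists s.
  by exists e, s.
by apply/asboolP; exists s => //; exact: edge_set_drawing es.
Qed.

Lemma crossed_drawing k p : open1 k p -> drawing_set D p ->
  crossed D k.
Proof. by move=> [s s01 <-] dp; apply/asboolP; exists s. Qed.

Lemma crossed_side (P : cell2 K) (i : 'I_(nsides P)) : crossed D (glued_to i) ->
  exists2 z, open_side (nsides P) i z & trace D P z.
Proof.
move=> /asboolP[s s01 ds].
have [|z zi pz] := @side_lift P i (char1 (glued_to i) s); first by exists s.
by exists z => //; split; [exact: open_side_disc zi|rewrite pz].
Qed.

Lemma edge_vertex_end e t v : t \in `[0, 1] -> epath D e t = vpos D v ->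
  exists2 b : bool, t = b%:R & ends e b = Some v.
Proof. exact: (emb_vertex_end emb). Qed.

(** An edge meets vertices only at the parameters 0 and 1. If one of these lies between [a] and [b],
    it equals [a] or [b]. *)
Lemma edge_segment_not_vertex e a b t : a \in `[0, 1] -> b \in `[0, 1] ->
  ~ is_vertex (epath D e a) -> ~ is_vertex (epath D e b) ->
  t \in `[a, b] -> ~ is_vertex (epath D e t).
Proof.
rewrite !in_itv /= => /andP[a0 a1] /andP[b0 b1] na nb /andP[ta tb] [v _ vt].
have t01 : t \in `[0, 1] by rewrite in_itv /= (le_trans a0 ta) (le_trans tb b1).
have [[] tE _] := edge_vertex_end t01 (esym vt).
- by apply: nb; exists v => //; rewrite vt; congr epath; rewrite /= in tE; lra.
- by apply: na; exists v => //; rewrite vt; congr epath; rewrite /= in tE; lra.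
Qed.

Lemma char2_path (P : cell2 K) (g : R -> R * R) (a b : R) :
  {within `[a, b], continuous g} -> (forall t, t \in `[a, b] -> disc (g t)) ->
  {within `[a, b], continuous (char2 P \o g)}.
Proof.
move=> cg gd; apply: (within_continuous_within_comp (B := @disc R)) => //.
- by move=> _ [t tab <-]; exact: gd.
- exact: (plcw_cont2 plcw).
Qed.

Lemma type_I_crossed (P : cell2 K) (i : 'I_(nsides P)) : type_I D P ->
  ~~ crossed D (glued_to i).
Proof. by move=> hI; apply/negP=> /crossed_side[z _]; rewrite hI. Qed.

(** The arc avoids the vertices, so both of its ends lie on the same edge. Its inner points lie in
    the open disc, so no side other than those of its two ends is crossed. *)
Lemma type_II_crosses (P : cell2 K) : type_II D P ->
  exists (i j : 'I_(nsides P)) e, [/\ i != j, crosses (glued_to i) e,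
    crosses (glued_to j) e
    & forall k, crossed D (glued_to k) -> k = i \/ k = j].
Proof.
case=> [i [j [arc [ij [carc iarc] [arc0 arc1 arco] tr tv]]]].
have z0 : (0 : R) \in `[0, 1] by rewrite in_itv /= lexx ler01.
have z1 : (1 : R) \in `[0, 1] by rewrite in_itv /= lexx ler01.
have arctr t : t \in `[0, 1] -> trace D P (arc t) by rewrite tr; exists t.
have narc t : t \in `[0, 1] -> ~ is_vertex (char2 P (arc t)).
  move=> /arctr[dt _] vt; have : trace_vertex D P (arc t) by [].
  by rewrite tv.
have [e he] := drawing_edge (arctr _ z0).2 (narc _ z0).
have [e' he'] := drawing_edge (arctr _ z1).2 (narc _ z1).
have ee' : e = e'.
  apply: (@path_edge (char2 P \o arc) 0 1 0 1) => //.
    by apply: char2_path => // t /arctr[].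
  by move=> u u01; split; [exact: (arctr u u01).2|exact: narc].
subst e'; exists i, j, e; split=> //.
- exact: crossesP (side_image arc0) he.
- exact: crossesP (side_image arc1) he'.
- move=> k /crossed_side[z zk]; rewrite tr => -[t t01 tz].
  rewrite -tz in zk; have := t01; rewrite /= in_itv /= => /andP[t0 t1].
  have [tt|tt|tt] := ltgtP t 0; first by move: t0; rewrite leNgt tt.
    have [uu|uu|uu] := ltgtP t 1; last 1 first.
    + by right; apply: open_side_inj zk _; rewrite uu.
    + by case: (open_sideN zk); apply: arco; rewrite in_itv /= tt.
    + by move: t1; rewrite leNgt uu.
  by left; apply: open_side_inj zk _; rewrite tt.
Qed.


(** * Half-edges at a trivalent vertex *)

Definition hpath (h : edge G * bool) (t : R) : T :=
  epath D h.1 (if h.2 then 1 - t else t).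
(** The bound 1/3, being less than 1/2, keeps the two half-edges of an edge disjoint except possibly
    at a common end point. *)
Definition half_set (h : edge G * bool) : set T := hpath h @` `[0, 3^-1].
Definition half_at (v : vertex G) (h : edge G * bool) : Prop :=
  ends h.1 h.2 = Some v.

Lemma hpath_param (h : edge G * bool) (t : R) :
  t \in `[0, 1] -> (if h.2 then 1 - t else t) \in `[0, 1].
Proof.
rewrite !in_itv /=; case: h.2 => // /andP[? ?].
by apply/andP; split; order_lra.
Qed.

Lemma third01 (t : R) : t \in `[0, 3^-1] -> t \in `[0, 1].
Proof. by rewrite !in_itv /= => /andP[? ?]; apply/andP; split; order_lra. Qed.

Lemma hpath_continuous h : {within `[0, 1], continuous (hpath h)}.
Proof.
apply: (@within_continuous_within_comp R R T `[0, 1]%classic `[0, 1]%classic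
  (fun t => if h.2 then 1 - t else t) (epath D h.1)).
- by move=> _ [t t01 <-]; exact: hpath_param.
- apply: continuous_subspaceT => t; case: h.2; last exact: cvg_id.
  by apply: cvgB; [exact: cvg_cst|exact: cvg_id].
- exact: (emb_cont emb).
Qed.

Lemma hpath_closed h (a b : R) : 0 <= a -> b <= 1 -> closed (hpath h @` `[a, b]).
Proof.
move=> a0 b1; apply: closed_path => //.
exact: within_continuous_subitv (@hpath_continuous h).
Qed.

Lemma half_set_closed h : closed (half_set h).
Proof. by apply: hpath_closed => //; order_lra. Qed.

Lemma hpath0 h v : half_at v h -> hpath h 0 = vpos D v.
Proof.
by move=> /(emb_end emb) <-; rewrite /hpath; case: h.2 => //=; rewrite subr0.
Qed.

Lemma hpath_vertex h t v : t \in `[0, 3^-1] -> hpath h t = vpos D v ->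
  t = 0 /\ half_at v h.
Proof.
move=> t3; have := t3; rewrite in_itv /= => /andP[t0 t1].
rewrite /hpath => /edge_vertex_end; rewrite /half_at.
case/(_ (hpath_param h (third01 t3))) => b; case: h.2; case: b => /= tE hb.
all: by first [exfalso; order_lra|split=> //; order_lra].
Qed.

(** The two halves of one edge have parameters at most 1/3 and at least 2/3, so they cannot be
    confused. The identification of the two ends of a circle would force [t] to be 0, where [h] is
    at the vertex [v]. *)
Lemma hpath_inj h h' t t' v : t \in `[0, 3^-1] -> t' \in `[0, 3^-1] ->
  half_at v h -> hpath h t = hpath h' t' -> ~ is_vertex (hpath h t) ->
  h = h' /\ t = t'.
Proof.
move=> t3 t3' hv hh nv.
have tn0 : t <> 0 by move=> t0; apply: nv; exists v => //; rewrite t0 (hpath0 hv).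
have := emb_inj emb (hpath_param h (third01 t3))
  (hpath_param h' (third01 t3')) hh.
move: t3 t3'; rewrite !in_itv /= => /andP[t0 t1] /andP[t0' t1'].
case=> [[]|[w ht]|[_ [b [+ _]]]].
- case: h h' {hv hh nv} => [e b] [e' b'] /= <-.
  by case: b; case: b' => tt; first [exfalso; order_lra|split=> //; order_lra].
- by case: nv; exists w => //; rewrite -ht.
- by case: h.2; case: b => /= tE; order_lra.
Qed.

(** * Legs issuing from a vertex *)

Section LegGerm.
Variables (v : vertex G).

Definition is_leg (g : R -> T) : Prop :=
  [/\ {within `[0, 1], continuous g}, g 0 = vpos D v
    & forall t, t \in `]0, 1] -> drawing_set D (g t) /\ ~ is_vertex (g t)].

Definition starts_along (g : R -> T) (d : R) (h : edge G * bool) : Prop :=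
  [/\ 0 < d < 1, half_at v h & forall t, t \in `[0, d] -> half_set h (g t)].

(** The middle thirds of all edges and the half-edges not at [v] form a closed set [B] that misses
    [v], so an initial segment of [g] avoids [B]. What is left of the drawing there is the
    half-edges at [v], and these are disjoint outside [v], so the leg follows a single one. *)
Lemma leg_germ g : is_leg g -> exists h d, starts_along g d h.
Proof.
case=> cg g0 gD.
pose B := (\bigcup_(e in [set: edge G]) (hpath (e, false) @` `[3^-1, 2 / 3]))
  `|` \bigcup_(h in [set h | ~ half_at v h]) half_set h.
have cB : closed B.
  apply: closedU; apply: closed_bigcup.
  - exact: finite_finset.
  - by move=> e _; apply: hpath_closed; order_lra.
  - exact: finite_finset.
  - by move=> h _; exact: half_set_closed.
have nB : ~ B (g 0).
  rewrite g0; case=> [[e _ [t]]|[h hv [t t3 /hpath_vertex]]].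
    rewrite /= in_itv /= /hpath /= => /andP[t0 t1] /edge_vertex_end.
    case; first by rewrite in_itv /=; apply/andP; split; order_lra.
    by case=> /= tE _; order_lra.
  by case/(_ t3).
have [d d01 dB] : exists2 d, 0 < d < 1 & forall t, t \in `[0, d] -> ~ B (g t).
  have /subspace_continuousP/(_ 0) := cg.
  have z01 : `[0, 1]%classic (0 : R) by rewrite /= in_itv /= lexx ler01.
  case/(_ z01 (~` B)).
    by apply: open_nbhs_nbhs; split => //; exact: closed_openC.
  (* Halving keeps [d] strictly within radius [r] and strictly below 1. *)
  move=> r /= r0 rB; exists (Num.min r 1 / 2).
    have : 0 < Num.min r 1 <= 1; last by order_lra.
    by rewrite lt_min r0 ltr01 ge_min lexx orbT.
  have rr : Num.min r 1 <= r by rewrite ge_min lexx.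
  have r1 : Num.min r 1 <= 1 by rewrite ge_min lexx orbT.
  move=> t; rewrite in_itv /= => /andP[t0 td].
  apply: rB; last by rewrite in_itv /= t0 /=; order_lra.
  by rewrite /= sub0r normrN ger0_norm //; order_lra.
have cov t : t \in `]0, d] -> exists2 h, half_at v h & half_set h (g t).
  move=> tI; have [|dr nv] := gD t.
    by move: tI; rewrite !in_itv /= => /andP[? ?]; apply/andP; split; order_lra.
  have nBt : ~ B (g t).
    apply: dB; move: tI; rewrite !in_itv /= => /andP[? ?].
    by apply/andP; split; order_lra.
  suff [h ht] : exists h, half_set h (g t).
    by exists h => //; apply: contrapT => nh; apply: nBt; right; exists h.
  have [e [s]] := drawing_edge dr nv.
  rewrite /= in_itv /= => /andP[s0 s1] gs.
  have [s3|s3] := lerP s 3^-1.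
    by exists (e, false), s => //=; rewrite in_itv /= s0 s3.
  have [s4|s4] := lerP s (2 / 3).
    case: nBt; left; exists e => //; exists s; last exact: gs.
    by rewrite /= in_itv /= s4 ltW.
  (* Parameters beyond 2/3 belong to the half-edge at the other end. *)
  rewrite -gs; exists (e, true), (1 - s).
    by rewrite /= in_itv /=; apply/andP; split; order_lra.
  by rewrite /hpath /=; congr (epath D e _); order_lra.
have dI : d \in `]0, d] by rewrite in_itv /= lexx; case/andP: d01 => ->.
have [h hv hd] := cov _ dI.
exists h, d; split=> // t tI.
have [t0|t0] := eqVneq t 0.
  exists 0; first by rewrite /= in_itv /= lexx /=; order_lra.
  by rewrite t0 g0 (hpath0 hv).
have tp : 0 < t by move: tI; rewrite in_itv /= lt0r t0 => /andP[->].
have td : t <= d by move: tI; rewrite in_itv /= => /andP[].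
have [|h' hv' ht] := cov t; first by rewrite in_itv /= tp td.
have tdI u : u \in `[t, d] -> u \in `]0, d].
  by rewrite !in_itv /= => /andP[? ?]; apply/andP; split; order_lra.
(* The half-edges all share [v], so the connectedness argument runs on the interval from [t] to [d],
   with [t] positive. *)
suff -> : h = h' by [].
apply: (@path_label R T _ g t d half_set d t) => //.
- by apply: (within_continuous_subitv _ _ cg); order_lra.
- exact: half_set_closed.
- by move=> u /tdI/cov[h1 _ ?]; exists h1.
- move=> u h1 h2 /[dup] /tdI uI uI' [s1 s13 g1] [s2 s23 g2].
  have nBu : ~ B (g u).
    apply: dB; move: uI; rewrite !in_itv /= => /andP[? ?].
    by apply/andP; split; order_lra.
  have hv1 : half_at v h1.
    by apply: contrapT => nh; apply: nBu; right; exists h1 => //; exists s1.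
  suff [] : h1 = h2 /\ s1 = s2 by [].
  apply: (hpath_inj s13 s23 hv1); first by rewrite g1 g2.
  rewrite g1; apply: (gD u _).2.
  by move: uI; rewrite !in_itv /= => /andP[? ?]; apply/andP; split; order_lra.
- by rewrite in_itv /= lexx td.
- by rewrite in_itv /= lexx td.
Qed.

(** Past [d] the leg still avoids the vertices, so it remains on the edge of [h] up to its end on
    the side of the polygon. *)
Lemma leg_edge g d h e : is_leg g -> starts_along g d h ->
  edge_set e (g 1) -> h.1 = e.
Proof.
case=> cg g0 gD [/andP[d0 d1] hv hd] ge.
apply: (@path_edge g d 1 d 1) => //.
- by apply: (within_continuous_subitv _ _ cg); order_lra.
- move=> u uI; apply: gD; move: uI; rewrite !in_itv /= => /andP[? ?].
  by apply/andP; split; order_lra.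
- by rewrite in_itv /= lexx ltW.
- by rewrite in_itv /= lexx ltW.
- have [|s s3 <-] := hd d; first by rewrite in_itv /= lexx ltW.
  by eexists; [exact: (hpath_param h (third01 s3))|].
Qed.

(* Otherwise the path reaching further along [h] would avoid the point where the
   other one stops, which separates [h]. *)
Lemma legs_meet g1 g2 d1 d2 h : is_leg g1 -> is_leg g2 ->
  starts_along g1 d1 h -> starts_along g2 d2 h ->
  exists t1 t2, [/\ t1 \in `]0, 1[, t2 \in `]0, 1[ & g1 t1 = g2 t2].
Proof.
move=> l1 l2 a1 a2.
have endp g d : is_leg g -> starts_along g d h ->
    exists2 s, s \in `[0, 3^-1] & hpath h s = g d.
  by move=> _ [/andP[d0 _] _]; apply; rewrite in_itv /= lexx ltW.
have [s1 s13 e1] := endp _ _ l1 a1; have [s2 s23 e2] := endp _ _ l2 a2.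
(* The parameters [s1] and [s2] measure how far along [h] the two initial segments end; by symmetry
   [g1] may be taken to reach no further than [g2]. *)
wlog s12 : g1 g2 d1 d2 s1 s2 l1 l2 a1 a2 s13 s23 e1 e2 / s1 <= s2.
  move=> W; have [s12|/ltW s21] := lerP s1 s2; first exact: (W g1 g2 d1 d2 s1 s2).
  have [t2 [t1 [? ? ?]]] := W _ _ _ _ _ _ l2 l1 a2 a1 s23 s13 e2 e1 s21.
  by exists t1, t2.
case: l1 l2 => [c1 z1 D1] [c2 z2 D2].
case: a1 a2 => [/andP[d10 d11] hv h1] [/andP[d20 d21] _ h2].
have nd1 : ~ is_vertex (g1 d1) by apply: (D1 d1 _).2; rewrite in_itv /= d10 ltW.
apply: contrapT => nomeet.
have nm t2 : t2 \in `[0, d2] -> g2 t2 <> g1 d1.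
  rewrite in_itv /= => /andP[t0 t1] gg.
  have [tz|tz] := eqVneq t2 0.
    by apply: nd1; exists v => //; rewrite -gg tz.
  apply: nomeet; exists d1, t2; split=> //; rewrite in_itv /=.
    by rewrite d10.
  by rewrite lt0r tz t0 (le_lt_trans t1).
move: (s13) (s23); rewrite !in_itv /= => /andP[p1 q1] /andP[p2 q2].
(* The point [g1 d1] cuts [h] into two closed pieces. The path [g2] starts in the first and ends in
   the second, and since it avoids the cut point the pieces are disjoint along it. *)
pose C (b : bool) := if b then hpath h @` `[0, s1] else hpath h @` `[s1, 3^-1].
suff : true = false by [].
apply: (@path_label R T bool g2 0 d2 C 0 d2).
- by apply: (within_continuous_subitv _ _ c2); order_lra.
- by case; apply: hpath_closed => //; order_lra.
- move=> u /h2[s]; rewrite /= in_itv /= => /andP[s0 s3] <-.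
  have [ss|/ltW ss] := lerP s s1; [exists true|exists false]; exists s => //=.
    by rewrite in_itv /= s0.
  by rewrite in_itv /= ss.
- have dis u : u \in `[0, d2] -> C true (g2 u) -> ~ C false (g2 u).
    move=> uI [a /= + ea] [b /= + eb]; rewrite !in_itv /=.
    move=> /andP[a0 a1] /andP[b0 b1].
    have a3 : a \in `[0, 3^-1] by rewrite in_itv /=; apply/andP; split; order_lra.
    have b3 : b \in `[0, 3^-1] by rewrite in_itv /=; apply/andP; split; order_lra.
    case: (pselect (is_vertex (g2 u))) => [[w _ wu]|nu].
      have [bz _] := hpath_vertex b3 (etrans eb (esym wu)).
      apply: nd1; exists v => //; rewrite -e1.
      by have -> : s1 = 0; [order_lra|rewrite (hpath0 hv)].
    have [|_ ab] := hpath_inj a3 b3 hv (etrans ea (esym eb)).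
      by rewrite ea.
    apply: (nm u uI); rewrite -ea -e1; congr (hpath h _); order_lra.
  by move=> u [] [] uI // A B; [case: (dis u uI A B)|case: (dis u uI B A)].
- by rewrite in_itv /= lexx ltW.
- by rewrite in_itv /= lexx ltW.
- by exists 0; [rewrite /= in_itv /= lexx|rewrite (hpath0 hv) z2].
- by exists s2 => //=; rewrite in_itv /= s12.
Qed.

End LegGerm.

(** Two legs along the same half-edge would meet away from the vertex. As [char2 P] is injective on
    the open disc, they would already meet in the polygon away from its center, which type III
    excludes. The last clause serves to recognize [v] as a prescribed vertex of the graph. *)
Lemma type_III_crosses (P : cell2 K) : type_III D P ->
  nsides P = 3%N /\ exists v (h : 'I_(nsides P) -> edge G * bool),
  [/\ injective h, forall i, half_at v (h i),
      forall i, crosses (glued_to i) (h i).1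
    & forall w z, disc z -> char2 P z = vpos D w -> w = v].
Proof.
case=> n3 [x [leg [hleg legdis tr tv]]]; split=> //.
have i0 : 'I_(nsides P) by rewrite n3; exact: ord0.
have z0 : (0 : R) \in `[0, 1] by rewrite in_itv /= lexx ler01.
have z1 : (1 : R) \in `[0, 1] by rewrite in_itv /= lexx ler01.
have legtr i t : t \in `[0, 1] -> trace D P (leg i t).
  by move=> t01; rewrite tr; exists i => //; exists t.
have [dx [v _ vx]] : trace_vertex D P x by rewrite tv.
have isleg i : is_leg v (char2 P \o leg i).
  have [cl il l0 lo _] := hleg i; split.
  - by apply: char2_path => // t t01; exact: (legtr i t t01).1.
  - by rewrite /= l0.
  - move=> t; rewrite in_itv /= => /andP[t0 t1].
    have t01 : t \in `[0, 1] by rewrite in_itv /= t1 ltW.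
    split; first exact: (legtr i t t01).2.
    move=> vt; have : trace_vertex D P (leg i t).
      by split=> //; exact: (legtr i t t01).1.
    rewrite tv /= -l0 => /il; rewrite t01 z0 => /(_ isT isT) tz.
    by move: t0; rewrite tz ltxx.
have germ i : exists hd : (edge G * bool) * R,
    starts_along v (char2 P \o leg i) hd.2 hd.1.
  by have [h [d hd]] := leg_germ (isleg i); exists (h, d).
have [hd hhd] := choice germ.
exists v, (fun i => (hd i).1); split.
- move=> i j hij; apply: contrapT => nij.
  have := hhd j; rewrite -hij => hj.
  have [t [t' [tI tI' /= e]]] := legs_meet (isleg i) (isleg j) (hhd i) hj.
  have [_ _ _ loi _] := hleg i; have [_ _ _ loj _] := hleg j.
  have sub01 (u : R) : u \in `]0, 1[ -> (u \in `[0, 1[) /\ (u \in `[0, 1]).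
    rewrite !in_itv /= => /andP[? ?].
    by split; apply/andP; split=> //; apply: ltW.
  have /(plcw_inj2 plcw) : char2 P (leg i t) = char2 P (leg j t') by [].
  rewrite !inE => /(_ (loi _ (sub01 _ tI).1) (loj _ (sub01 _ tI').1)).
  move=> /(legdis _ _ _ _ (sub01 _ tI).2 (sub01 _ tI').2)[//|tz].
  by move: tI; rewrite tz in_itv /= ltxx.
- by move=> i; have [] := hhd i.
- move=> i; have [cl il l0 lo l1] := hleg i.
  have [e ge] : exists e, edge_set e (char2 P (leg i 1)).
    apply: drawing_edge; first exact: (legtr i 1 z1).2.
    exact: cell1_not_vertex (side_image l1).
  rewrite (leg_edge (isleg i) (hhd i) ge).
  exact: crossesP (side_image l1) ge.
- move=> w z dz zw; have : trace_vertex D P z by split=> //; exists w.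
  rewrite tv /= => zx; apply: (emb_vertex_inj emb).
  by rewrite -zw zx vx.
Qed.

(** * Labels along an edge *)

(** The open cell that contains the vertex is neither a 0-cell nor a 1-cell, and type III is the
    only type of polygon with a vertex. *)
Lemma vertex_gon v : exists (P : cell2 K) z,
  [/\ type_III D P, disc z & char2 P z = vpos D v].
Proof.
have dv : drawing_set D (vpos D v) by apply: vertex_drawing; exists v.
have := emb_sub emb dv; rewrite -(plcw_cover plcw) => -[[x|[k|P]] _].
- by move=> vx; case: (bord_miss hbord (v := x)); rewrite -vx.
- by move=> /(@cell1_not_vertex k) []; exists v.
- case=> z /open_disc_disc dz zv; exists P, z.
  have vz : trace_vertex D P z by split=> //; exists v.
  split=> //; case: (bord_gon hbord P) => //.
    by move=> hI; have : trace D P z by [split=> //; rewrite zv]; rewrite hI.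
  by case=> [i [j [arc [_ _ _ _ t0]]]]; move: vz; rewrite t0.
Qed.

(** This excludes the corners of the polygon. *)
Lemma trace_cell (P : cell2 K) z : trace D P z ->
  open_disc z \/ exists i : 'I_(nsides P), open_side (nsides P) i z.
Proof.
case: (bord_gon hbord P) => [->//|[i [j [arc [_ _ [a0 a1 ao] -> _]]]]|].
  case=> t; rewrite /= in_itv /= => /andP[t0 t1] <-.
  move: t0; rewrite le_eqVlt => /predU1P[<-|t0]; first by right; exists i.
  move: t1; rewrite le_eqVlt => /predU1P[->|t1]; first by right; exists j.
  by left; apply: ao; rewrite in_itv /= t0.
case=> _ [x [leg [hleg _ -> _]]] [i _ [t]].
rewrite /= in_itv /= => /andP[t0 t1] <-; have [_ _ _ lo l1] := hleg i.
move: t1; rewrite le_eqVlt => /predU1P[->|t1]; first by right; exists i.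
by left; apply: lo; rewrite in_itv /= t0.
Qed.

(** Following the arc, or the leg outwards from its vertex, leads from [z] to a side without meeting
    a vertex, hence along the edge of [z]. *)
Lemma strand (P : cell2 K) z : trace D P z -> ~ is_vertex (char2 P z) ->
  exists (i : 'I_(nsides P)) e, crosses (glued_to i) e /\ edge_set e (char2 P z).
Proof.
move=> trz nv; have [e ez] := drawing_edge trz.2 nv.
have z1 : (1 : R) \in `[0, 1] by rewrite in_itv /= lexx ler01.
case: (bord_gon hbord P) => [hI|[i [j [arc [_ [carc _] [_ a1 _] tr tv]]]]|].
- by move: trz; rewrite hI.
- move: (trz); rewrite tr => -[t t01 tz]; exists j, e; split=> //.
  have arctr u : u \in `[0, 1] -> trace D P (arc u) by rewrite tr; exists u.
  have narc u : u \in `[0, 1] -> ~ is_vertex (char2 P (arc u)).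
    move=> /arctr[du _] vu; have : trace_vertex D P (arc u) by [].
    by rewrite tv.
  have [e' he'] := drawing_edge (arctr _ z1).2 (narc _ z1).
  suff -> : e = e' by exact: crossesP (side_image a1) he'.
  apply: (@path_edge (char2 P \o arc) 0 1 t 1) => //.
  + by apply: char2_path => // u /arctr[].
  + by move=> u u01; split; [exact: (arctr u u01).2|exact: narc].
  + by rewrite /= tz.
- case=> _ [x [leg [hleg _ tr tv]]]; move: (trz); rewrite tr => -[i _ [t t01 tz]].
  have [cl il l0 lo l1] := hleg i; exists i, e; split=> //.
  have legtr u : u \in `[0, 1] -> trace D P (leg i u).
    by rewrite tr; exists i => //; exists u.
  have [t0 t1] : 0 <= t /\ t <= 1.
    by move: t01; rewrite /= in_itv /= => /andP[].
  have tI u : u \in `[t, 1] -> u \in `[0, 1].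
    by rewrite !in_itv /= => /andP[tu ->]; rewrite (le_trans t0 tu).
  have nleg u : u \in `[t, 1] -> ~ is_vertex (char2 P (leg i u)).
    move=> uI vu; have : trace_vertex D P (leg i u).
      by split=> //; exact: (legtr u (tI u uI)).1.
    have z0 : (0 : R) \in `[0, 1] by rewrite in_itv /= lexx ler01.
    rewrite tv /= -l0 => /il; rewrite (tI u uI) z0 => /(_ isT isT) uz.
    apply: nv; rewrite -tz; have -> // : t = u.
    by move: uI; rewrite uz in_itv /= => /andP[? _]; apply: le_anti; apply/andP.
  have [e' he'] : exists e', edge_set e' (char2 P (leg i 1)).
    apply: drawing_edge; first exact: (legtr 1 z1).2.
    by apply: nleg; rewrite in_itv /= t1 lexx.
  suff -> : e = e' by exact: crossesP (side_image l1) he'.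
  apply: (@path_edge (char2 P \o leg i) t 1 t 1) => //.
  + apply: char2_path => [|u /tI/legtr[] //].
    exact: within_continuous_subitv cl.
  + by move=> u uI; split; [exact: (legtr u (tI u uI)).2|exact: nleg].
  + by rewrite in_itv /= lexx t1.
  + by rewrite in_itv /= lexx t1.
  + by rewrite /= tz.
Qed.

Lemma drawing_trace p : drawing_set D p ->
  exists (P : cell2 K) z, trace D P z /\ char2 P z = p.
Proof.
move=> dp; have := emb_sub emb dp; rewrite -(plcw_cover plcw) => -[[x|[k|P]] _].
- by move=> px; case: (bord_miss hbord (v := x)); rewrite -px.
- have [P [i <-]] := side_exists k => /(@side_lift P i)[z /open_side_disc dz zp].
  by exists P, z; split=> //; split=> //; rewrite zp.
- case=> z /open_disc_disc dz zp.
  by exists P, z; split=> //; split=> //; rewrite zp.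
Qed.

(** The midpoint of [e] is not a vertex, and the strand through it leads to a side. Thus the color
    of every edge is visible on some 1-cell. *)
Lemma edge_crossed e : exists k, crosses k e.
Proof.
have h01 : (2^-1 : R) \in `[0, 1].
  by rewrite in_itv /=; apply/andP; split; order_lra.
have ee : edge_set e (epath D e 2^-1) by exists 2^-1.
have nv : ~ is_vertex (epath D e 2^-1).
  by case=> v _ /esym/(edge_vertex_end h01)[[] tE _]; rewrite /= in tE; order_lra.
have [P [z [tr zp]]] := drawing_trace (edge_set_drawing ee).
have [|i [e' [ke' ze']]] := strand tr; first by rewrite zp.
exists (glued_to i); rewrite zp in ze'.
by rewrite (edge_set_inj nv ee ze').
Qed.

Section Labels.
Variables (A : finType) (f : cell1 K -> A).
Hypothesis f_type_II : forall P : cell2 K, type_II D P ->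
  forall i j : 'I_(nsides P), crossed D (glued_to i) -> crossed D (glued_to j) ->
  f (glued_to i) = f (glued_to j).

(* [C a] is the part of the drawing in the polygon [P] that reaches a side with
   label [a]. *)
Definition gon_labels (P : cell2 K) (C : A -> set T) : Prop :=
  [/\ forall a, closed (C a),
      forall z, trace D P z -> exists a, C a (char2 P z),
      forall a p, C a p -> exists2 z, trace D P z & char2 P z = p,
      forall a b p, ~ is_vertex p -> open2 P p -> C a p -> C b p -> a = b
    & forall k a p, open1 k p -> C a p -> a = f k].

Lemma open12 k P p : open1 k p -> open2 P p -> False.
Proof. by move=> pk pP; have := open_cell_inj pk pP. Qed.

Lemma open11 k k' p : open1 k p -> open1 k' p -> k = k'.
Proof. by move=> pk pP; have [] := open_cell_inj pk pP. Qed.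

(** For type II the whole arc gets the common label of its two sides. For type III each leg gets the
    label of its side, and different legs share only the vertex. *)
Lemma gon_labels_exist P : exists C, gon_labels P C.
Proof.
have z0 : (0 : R) \in `[0, 1] by rewrite in_itv /= lexx ler01.
have z1 : (1 : R) \in `[0, 1] by rewrite in_itv /= lexx ler01.
case: (bord_gon hbord P) => [hI|hII|hIII].
- exists (fun=> set0); split=> //; first by move=> _; exact: closed0.
  by move=> z; rewrite hI.
- have [i [j [arc [ij [carc _] [a0 a1 ao] tr tv]]]] := hII.
  have arctr u : u \in `[0, 1] -> trace D P (arc u) by rewrite tr; exists u.
  exists (fun a => if a == f (glued_to i) then char2 P @` trace D P else set0).
  split.
  + move=> a; case: ifP => _; last exact: closed0.
    rewrite tr image_comp; apply: closed_path => //.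
    by apply: char2_path => // u /arctr[].
  + by move=> z trz; exists (f (glued_to i)); rewrite eqxx; exists z.
  + by move=> a p; case: ifP => // _ [z ? ?]; exists z.
  + by move=> a b p _ _; case: ifP => // /eqP ->; case: ifP => // /eqP ->.
  + move=> k a p kp; case: ifP => // /eqP -> [z trz zp].
    have tz : trace D P z by [].
    have crs (l : 'I_(nsides P)) : open1 (glued_to l) p -> crossed D (glued_to l).
      by move=> lp; apply: crossed_drawing lp _; rewrite -zp; exact: tz.2.
    have ci : crossed D (glued_to i).
      by apply: crossed_drawing (side_image a0) _; exact: (arctr 0 z0).2.
    case: (trace_cell tz) => [oz|[l lz]].
      by case: (open12 kp (P := P)); exists z.
    have lp : open1 (glued_to l) p by rewrite -zp; exact: side_image.
    rewrite (open11 kp lp); apply: f_type_II => //; exact: crs.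
- have [_ [x [leg [hleg legdis tr tv]]]] := hIII.
  have legtr i u : u \in `[0, 1] -> trace D P (leg i u).
    by rewrite tr; exists i => //; exists u.
  have leg_end i t p : t \in `[0, 1] -> char2 P (leg i t) = p ->
      open_disc (leg i t) \/ open1 (glued_to i) p.
    have [_ _ _ lo l1] := hleg i.
    rewrite in_itv /= => /andP[t0]; rewrite le_eqVlt => /predU1P[->|t1] <-.
      by right; exact: side_image.
    by left; apply: lo; rewrite in_itv /= t0.
  exists (fun a => \bigcup_(i in [set i | f (glued_to i) = a])
    ((char2 P \o leg i) @` `[0, 1])); split.
  + move=> a; apply: closed_bigcup => [|i _]; first exact: finite_finset.
    apply: closed_path => //; have [cl _ _ _ _] := hleg i.
    by apply: char2_path => // u u01; exact: (legtr i u u01).1.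
  + move=> z; rewrite tr => -[i _ [t t01 <-]].
    by exists (f (glued_to i)), i => //; exists t.
  + move=> a p [i _ [t t01 /= tp]]; exists (leg i t) => //; exact: legtr.
  + move=> a b p nv pP [i <- [t t01 /= tp]] [j <- [t' t01' /= tp']].
    case: (leg_end i t p t01 tp) => [oi|/open12/(_ pP)//].
    case: (leg_end j t' p t01' tp') => [oj|/open12/(_ pP)//].
    have : leg i t = leg j t'.
      by apply: (plcw_inj2 plcw (P := P)); rewrite ?inE // tp tp'.
    case/(legdis _ _ _ _ t01 t01') => [-> //|tz].
    case: nv; rewrite -tp tz; have [_ _ -> _ _] := hleg i.
    by have [] : trace_vertex D P x by rewrite tv.
  + move=> k a p kp [i <- [t t01 /= tp]].
    case: (leg_end i t p t01 tp) => [oi|ip]; last by rewrite (open11 kp ip).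
    by case: (open12 kp (P := P)); exists (leg i t).
Qed.

(** The local pieces are glued into sets [F a], closed because there are finitely many polygons. Off
    the vertices they are disjoint: on a 1-cell [l] the label must be [f l], and any other point of
    the drawing lies in one open polygon only. Between its two crossings the edge meets no vertex,
    so the label cannot change. *)
Lemma crosses_label k k' e : crosses k e -> crosses k' e -> f k = f k'.
Proof.
have [C hC] := choice gon_labels_exist.
pose F (a : A) : set T := \bigcup_(P in [set: cell2 K]) C P a.
have Fcov p : drawing_set D p -> exists a, F a p.
  move=> /drawing_trace[P [z [trz <-]]].
  by have [_ /(_ z trz)[a Ca] _ _ _] := hC P; exists a, P.
have F1 l p a : open1 l p -> F a p -> a = f l.
  by move=> lp [P _ CP]; have [_ _ _ _ /(_ l a p lp)] := hC P; apply.
have Fdis p a b : ~ is_vertex p -> F a p -> F b p -> a = b.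
  move=> nv Fa Fb.
  case: (pselect (exists l, open1 l p)) => [[l lp]|n1].
    by rewrite (F1 l p a lp Fa) (F1 l p b lp Fb).
  have inP P c : C P c p -> open2 P p.
    have [_ _ sub _ _] := hC P => /sub[z trz zp].
    have [oz|[i iz]] := trace_cell trz; first by exists z.
    by case: n1; exists (glued_to i); rewrite -zp; exact: side_image.
  case: Fa Fb => [P _ Pa] [Q _ Qb].
  have [QP] := open_cell_inj (inP _ _ Qb) (inP _ _ Pa); rewrite QP in Qb.
  have [_ _ _ dis _] := hC P.
  exact: dis nv (inP _ _ Pa) Pa Qb.
have Fk l s p : s \in `]0, 1[ -> p = char1 l s -> drawing_set D p ->
    F (f l) p /\ ~ is_vertex p.
  move=> s01 ps dp; have lp : open1 l p by rewrite ps; exists s.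
  have [a Fa] := Fcov p dp; rewrite -(F1 l p a lp Fa); split=> //.
  exact: cell1_not_vertex lp.
move=> [s s01 [t /= t01 tk]] [s' s01' [t' /= t01' tk']].
have dr u : u \in `[0, 1] -> drawing_set D (epath D e u).
  by move=> u01; apply: (@edge_set_drawing e); exists u.
have [Fs ns] := Fk _ _ _ s01 tk (dr t t01).
have [Fs' ns'] := Fk _ _ _ s01' tk' (dr t' t01').
wlog tt' : k k' s s' t t' {s01 s01' tk tk'} t01 t01' Fs Fs' ns ns' / t <= t'.
  move=> W; have [tt'|/ltW tt'] := lerP t t'; first exact: (W k k' s s' t t').
  by apply: esym; exact: (W k' k s' s t' t).
move: (t01) (t01'); rewrite !in_itv /= => /andP[t0 t1] /andP[t0' t1'].
have sub u : u \in `[t, t'] -> u \in `[0, 1].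
  rewrite !in_itv /= => /andP[tu ut].
  by rewrite (le_trans t0 tu) (le_trans ut t1').
apply: (@path_label R T A (epath D e) t t' F t t') => //.
- exact: within_continuous_subitv (emb_cont emb (e := e)).
- move=> a; apply: closed_bigcup => [|P _]; first exact: finite_finset.
  by have [] := hC P.
- by move=> u /sub/dr/Fcov.
- by move=> u a b uI; apply: Fdis; exact: edge_segment_not_vertex uI.
- by rewrite in_itv /= lexx.
- by rewrite in_itv /= lexx andbT.
Qed.

End Labels.

(** * Labellings and Tait colorings *)

Definition edge_at (k : cell1 K) : option (edge G) :=
  [pick e | `[< crosses k e >]].

Lemma edge_atE k e : crosses k e -> edge_at k = Some e.
Proof.
move=> ke; rewrite /edge_at; case: pickP => [e' /asboolP ke'|/(_ e)].
  by rewrite (crosses_inj ke ke').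
by move=> /asboolP.
Qed.

Lemma edge_at_crossed k : isSome (edge_at k) = crossed D k.
Proof.
apply/idP/idP => [|/crossedP[e /edge_atE -> //]].
rewrite /edge_at; case: pickP => // e /asboolP ke _.
by apply/crossedP; exists e.
Qed.

Definition cell_color (c : {ffun edge G -> color}) (k : cell1 K) :
  option color := omap c (edge_at k).

Lemma cell_colorE c k e : crosses k e -> cell_color c k = Some (c e).
Proof. by rewrite /cell_color => /edge_atE ->. Qed.

Lemma isSome_cell_color c k : isSome (cell_color c k) = crossed D k.
Proof. by rewrite -edge_at_crossed /cell_color; case: edge_at. Qed.

Lemma cell_color_basis (I : finType) (p : I -> cell1 K)
    (c : {ffun edge G -> color}) :
  [forall i : I,
    isSome ([ffun j : I => cell_color c (p j)] i) == crossed D (p i)].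
Proof. by apply/forallP => i; rewrite ffunE isSome_cell_color. Qed.

Definition color_basis (I : finType) (p : I -> cell1 K)
    (c : {ffun edge G -> color}) : Defs.basis (fun i : I => crossed D (p i)) :=
  exist (fun f : {ffun I -> option color} =>
    [forall i, isSome (f i) == crossed D (p i)]) _ (cell_color_basis p c).

Definition label_of (c : {ffun edge G -> color}) :
    Defs.basis (in_crossed (K:=K) D) * Defs.basis (Q_crossed (K:=K) D) :=
  (color_basis (fun e : in_cell K => val e) c,
   color_basis (fun s : Q_side K => side_cell (val s)) c).

Definition Qside (s : side K) : Q_side K := exist _ s (hin (side_cell s)).

Lemma Q_side_exists k : exists s : Q_side K, side_cell (val s) = k.
Proof.
have [P [i ik]] := side_exists k.
by exists (Qside (Tagged (fun P : cell2 K => 'I_(nsides P)) i)).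
Qed.

(** Each edge crosses a 1-cell, whose label is the color of the edge. *)
Lemma label_of_inj : injective label_of.
Proof.
move=> c c' [_ qq]; apply/ffunP => e; have [k ke] := edge_crossed e.
have [s sk] := Q_side_exists k.
have := congr1 (fun g : {ffun Q_side K -> option color} => g s) qq.
by rewrite /= !ffunE sk !(cell_colorE _ ke) => -[].
Qed.

Lemma side_labelE (u : Defs.basis (in_crossed (K:=K) D))
    (q : Defs.basis (Q_crossed (K:=K) D)) (s : side K) :
  side_label u q s = val q (Qside s).
Proof.
rewrite /side_label insubF ?(negbTE (hin _)) //.
by rewrite (insubT (fun s => ~~ inb (side_cell s)) (hin (side_cell s))).
Qed.

Lemma isSome_basis (I : finType) (m : pred I) (q : Defs.basis m) i :
  isSome (val q i) = m i.
Proof. by have /forallP/(_ i)/eqP := valP q. Qed.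

(** * Admissible labels of a polygon *)

Definition gon_admissible n (f : 'I_n -> option color) : bool :=
  let s := pmap f (enum 'I_n) in
  [|| size s == 0%N, (size s == 2) && constant s | (size s == 3) && uniq s].

Lemma eval_gonE (P : cell2 K) (f : 'I_(nsides P) -> option color) :
  eval_gon f = (gon_admissible f)%:R.
Proof.
rewrite /eval_gon /gon_admissible.
case: (pmap _ _) => [|x [|y [|z [|w s]]]] //=.
by rewrite /pairing andbT orbF eq_sym.
Qed.

Lemma size_pmap_enum n (f : 'I_n -> option color) :
  size (pmap f (enum 'I_n)) = #|[pred i | isSome (f i)]|.
Proof.
rewrite size_pmap cardE [in RHS]/enum_mem -enumT size_filter.
exact: eq_count.
Qed.

(** Exactly two sides are crossed, so [pmap] leaves a list of length 2. *)
Lemma admissible_II (P : cell2 K) (x : cell1 K -> option color) :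
  (forall k, isSome (x k) = crossed D k) -> type_II D P ->
  gon_admissible (fun i : 'I_(nsides P) => x (glued_to i)) <->
  (forall i j : 'I_(nsides P), crossed D (glued_to i) ->
    crossed D (glued_to j) -> x (glued_to i) = x (glued_to j)).
Proof.
move=> xc /type_II_crosses[i [j [e [ij ie je kij]]]].
have ci : crossed D (glued_to i) by apply/crossedP; exists e.
have cj : crossed D (glued_to j) by apply/crossedP; exists e.
rewrite /gon_admissible; set s := pmap _ _.
have -> : size s = 2%N.
  rewrite size_pmap_enum (@eq_card _ _ (pred2 i j)) ?card2 ?ij // => k.
  rewrite !inE xc; apply/idP/orP => [/kij[]->|[]/eqP->//]; rewrite ?eqxx;
    by [left|right].
have mems (l : 'I_(nsides P)) a : x (glued_to l) = Some a -> a \in s.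
  by move=> xa; rewrite mem_pmap; apply/mapP; exists l; rewrite ?mem_enum.
rewrite orbF /=; split=> [cs k l|h].
  rewrite -!xc; case xk: (x _) => [a|//] _; case xl: (x _) => [b|//] _.
  move: cs (mems _ _ xk) (mems _ _ xl); case: (s) => //= y t /allP ct.
  have yt z : z \in y :: t -> z = y.
    by rewrite inE => /orP[/eqP//|/ct/eqP].
  by move=> /yt -> /yt ->.
have xs a : a \in s -> Some a = x (glued_to i).
  rewrite mem_pmap => /mapP[k _ xk]; rewrite xk; apply: h => //.
  by rewrite -xc -xk.
case: (s) xs => //= y t xs; apply/allP => z zt /=; apply/eqP.
have zi : Some z = x (glued_to i) by apply: xs; rewrite inE zt orbT.
have yi : Some y = x (glued_to i) by apply: xs; rewrite inE eqxx.
by move: zi; rewrite -yi => -[].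
Qed.

(** All three sides are crossed, so [pmap] drops nothing and the list lists the values at all the
    sides. *)
Lemma admissible_III (P : cell2 K) (x : cell1 K -> option color) :
  (forall k, isSome (x k) = crossed D k) -> type_III D P ->
  gon_admissible (fun i : 'I_(nsides P) => x (glued_to i)) <->
  injective (fun i : 'I_(nsides P) => x (glued_to i)).
Proof.
move=> xc /type_III_crosses[n3 [v [h [_ _ hc _]]]].
have xs i : isSome (x (glued_to (i : 'I_(nsides P)))).
  by rewrite xc; apply/crossedP; exists (h i).1.
have /choice[y xy] (i : 'I_(nsides P)) : exists a, x (glued_to i) = Some a.
  by have := xs i; case: (x _) => // a _; exists a.
have pE : pmap (fun i : 'I_(nsides P) => x (glued_to i)) (enum 'I_(nsides P)) =
    map y (enum 'I_(nsides P)).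
  by elim: (enum _) => //= i s ->; rewrite xy.
have s3 : size (map y (enum 'I_(nsides P))) = 3%N.
  by rewrite size_map -cardE card_ord.
rewrite /gon_admissible pE s3 /=.
split=> [/injectiveP yi i j|xi].
  by rewrite !xy => -[/yi].
by apply/injectiveP => i j yij; apply: xi; rewrite !xy yij.
Qed.

Lemma admissible_I (P : cell2 K) (x : cell1 K -> option color) :
  (forall k, isSome (x k) = crossed D k) -> type_I D P ->
  gon_admissible (fun i : 'I_(nsides P) => x (glued_to i)).
Proof.
move=> xc hI; rewrite /gon_admissible size_pmap_enum eq_card0 // => i.
by rewrite !inE xc (negbTE (type_I_crossed i hI)).
Qed.

Lemma cell_color_admissible (c : {ffun edge G -> color}) (P : cell2 K) :
  is_tait c ->
  gon_admissible (fun i : 'I_(nsides P) => cell_color c (glued_to i)).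
Proof.
move=> tc; case: (bord_gon hbord P) => hP.
- exact: (admissible_I (isSome_cell_color c) hP).
- apply/(admissible_II (isSome_cell_color c) hP) => k l.
  have [i [j [e [ij ie je kij]]]] := type_II_crosses hP.
  by move=> /kij[]-> /kij[]->; rewrite ?(cell_colorE _ ie) ?(cell_colorE _ je).
- apply/(admissible_III (isSome_cell_color c) hP) => i j.
  have [_ [v [h [hi hv hc _]]]] := type_III_crosses hP.
  rewrite !(cell_colorE _ (hc _)) => -[cij]; apply: contrapT => /eqP nij.
  move: tc => /forallP/(_ v)/forallP/(_ (h i))/forallP/(_ (h j)).
  by rewrite !hv !eqxx (inj_eq hi) nij /= cij eqxx.
Qed.

(** Constancy along edges makes the color of an edge well defined. The Tait condition at a vertex is
    read off the polygon of type III around it, whose three sides have distinct labels. *)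
Lemma admissible_tait (x : cell1 K -> option color) :
  (forall k, isSome (x k) = crossed D k) ->
  (forall P : cell2 K,
    gon_admissible (fun i : 'I_(nsides P) => x (glued_to i))) ->
  exists c : {ffun edge G -> color}, is_tait c /\ x = cell_color c.
Proof.
move=> xc adm.
have lab := @crosses_label _ x (fun P hP => (admissible_II xc hP).1 (adm P)).
have /choice[c hc] e : exists a, forall k, crosses k e -> x k = Some a.
  have [k0 ke0] := edge_crossed e.
  have : isSome (x k0) by rewrite xc; apply/crossedP; exists e.
  case xk0: (x k0) => [a|//] _; exists a => k ke.
  by rewrite -xk0; exact: lab ke ke0.
exists (finfun c); split; last first.
  apply/funext => k; case kc: (crossed D k).
    by have /crossedP[e ke] := kc; rewrite (hc e k ke) (cell_colorE _ ke) ffunE.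
  have := xc k; have := isSome_cell_color (finfun c) k; rewrite kc.
  by case: (x k) => //; case: cell_color.
apply/forallP => v; apply/forallP => h; apply/forallP => h'.
apply/implyP => /and3P[/eqP hv /eqP hv' hh'].
have [P [z [hP dz zv]]] := vertex_gon v.
have [n3 [w [g [gi gw gc gP]]]] := type_III_crosses hP.
have vw := gP _ _ dz zv; subst w.
(* The three legs follow distinct half-edges at [v], and trivalency says that there are no
   others. *)
have onto : codom g =i [pred h : edge G * bool | ends h.1 h.2 == Some v].
  apply/subset_cardP; first by rewrite card_codom // card_ord n3 trivalent.
  by apply/fintype.subsetP => _ /codomP[i ->]; rewrite inE; apply/eqP; exact: gw.
have /codomP[i hi] : h \in codom g by rewrite onto inE hv.
have /codomP[j hj] : h' \in codom g by rewrite onto inE hv'.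
rewrite !ffunE; apply: contra hh' => /eqP cc.
have ij : i = j.
  apply: ((admissible_III xc hP).1 (adm P)).
  by rewrite (hc _ _ (gc i)) (hc _ _ (gc j)) -hi -hj cc.
by rewrite hi hj ij.
Qed.

(** * The state sum in coordinates *)

Lemma E_SigmaE (u : Defs.basis (in_crossed (K:=K) D))
    (q : Defs.basis (Q_crossed (K:=K) D)) (x : cell1 K -> option color) :
  (forall s, val q s = x (side_cell (val s))) ->
  E_Sigma u q =
  \prod_(P : cell2 K)
    (gon_admissible (fun i : 'I_(nsides P) => x (glued_to i)))%:R.
Proof.
move=> qx; apply: eq_bigr => P _; rewrite eval_gonE; congr (gon_admissible _)%:R.
by apply/funext => i; rewrite side_labelE qx.
Qed.

(** Only the basis vector [x e] contributes to the sum: any other one disagrees with the label of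
    some side glued to [e], and such a side exists. *)
Lemma copairing_consistent (q : Defs.basis (Q_crossed (K:=K) D))
    (v : Defs.basis (out_crossed (K:=K) D)) (x : cell1 K -> option color) e :
  (forall s, val q s = x (side_cell (val s))) -> copairing e q v = 1.
Proof.
move=> qx; have [s0 s0e] := Q_side_exists e.
rewrite /copairing (bigD1 (x e)) /=; last first.
  by rewrite -s0e -qx isSome_basis.
rewrite [X in _ + X]big1 ?addr0 => [|y /andP[_ yx]].
  rewrite big1 ?mul1r => [|s /eqP se]; last by rewrite qx se eqxx.
  by rewrite big1 // => o; have := valP o; rewrite (negbTE (hout _)).
by rewrite (bigD1 s0) ?s0e //= qx s0e eq_sym (negbTE yx) !mul0r.
Qed.

(** No basis vector agrees with both labels, so every term of the copairing at the common 1-cell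
    vanishes. *)
Lemma P_Sigma_inconsistent (q : Defs.basis (Q_crossed (K:=K) D))
    (v : Defs.basis (out_crossed (K:=K) D)) (s s' : Q_side K) :
  side_cell (val s) = side_cell (val s') -> val q s <> val q s' ->
  P_Sigma q v = 0.
Proof.
move=> ss' qss'; rewrite /P_Sigma (bigD1 (side_cell (val s))) ?hin //=.
rewrite [X in X * _]big1 ?mul0r // => y _.
case: (eqVneq (val q s) y) => [qy|qy].
  rewrite (bigD1 s') ?ss' //= -qy (_ : _ == _ = false) ?mul0r //.
  by apply/eqP => /esym.
by rewrite (bigD1 s) //= (negbTE qy) !mul0r.
Qed.

(** A nonzero weight forces the side labels to come from an admissible labelling [x] of the 1-cells,
    hence from a Tait coloring; conversely every factor is 1 for a Tait coloring. *)
Lemma chi_weight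
    (b : Defs.basis (in_crossed (K:=K) D) * Defs.basis (Q_crossed (K:=K) D))
    (v : Defs.basis (out_crossed (K:=K) D)) :
  E_Sigma b.1 b.2 * P_Sigma b.2 v =
  (b \in label_of @: [pred c | is_tait c])%:R.
Proof.
case: b => u q /=.
case: (boolP (_ \in _)) => [/imsetP[c tc [-> ->]]|nb].
  have qc s : val (color_basis (fun s : Q_side K => side_cell (val s)) c) s
      = cell_color c (side_cell (val s)) by rewrite ffunE.
  rewrite (E_SigmaE _ qc) big1 ?mul1r => [|P _].
    by rewrite /P_Sigma big1 // => e _; exact: copairing_consistent qc.
  by rewrite cell_color_admissible.
case: (pselect (forall s s' : Q_side K,
    side_cell (val s) = side_cell (val s') -> val q s = val q s'))
  => [qs|]; last first.
  move=> /existsNP[s /existsNP[s' /not_implyP[ss' qss']]].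
  by rewrite (P_Sigma_inconsistent _ ss' qss') mulr0.
have /choice[x xs] k : exists a, forall s, side_cell (val s) = k -> val q s = a.
  by have [s0 <-] := Q_side_exists k; exists (val q s0) => s; exact: qs.
have qx s : val q s = x (side_cell (val s)) by exact: xs.
rewrite (E_SigmaE _ qx).
case: (pselect (forall P : cell2 K,
    gon_admissible (fun i : 'I_(nsides P) => x (glued_to i)))) => [adm|].
  have xc k : isSome (x k) = crossed D k.
    by have [s0 <-] := Q_side_exists k; rewrite -qx isSome_basis.
  have [c [tc xE]] := admissible_tait xc adm.
  case/negP: nb; apply/imsetP; exists c => //; congr (_, _).
    (* The in-boundary is empty, so the first component carries no information. *)
    by apply/val_inj/ffunP => e; have := valP e; rewrite (negbTE (hin _)).
  by apply/val_inj/ffunP => s; rewrite qx xE ffunE.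
by move=> /existsNP[P /negP/negbTE nP]; rewrite (bigD1 P) //= nP !mul0r.
Qed.

Lemma chi_cw_tait (z : R[i]) :
  chi_cw (tens_scalar (in_crossed (K:=K) D) z)
  = tens_scalar (out_crossed (K:=K) D) ((tait_number G)%:R * z).
Proof.
apply/ffunP => v; rewrite !ffunE.
under eq_bigr => b _ do
  rewrite !ffunE /= mulrCA chi_weight mulr_natr mulrb.
(* The sum of the indicators is the size of the image of the Tait colorings under the injective map
   [label_of]. *)
rewrite -big_mkcond sumr_const mulr_natl; congr (_ *+ _).
by rewrite card_imset //; exact: label_of_inj.
Qed.

End ClosedBordism.

Theorem theorem5p18 (R : realType) (G : trivalent_graph)
    (D : drawing R 'rV[R]_3 G) (K : cells R 'rV[R]_3)
    (hbord : is_bordism D K (sphere R))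
    (hin : forall e : cell1 K, ~~ inb e)
    (hout : forall e : cell1 K, ~~ outb e) :
  forall z : R[i],
    chi_cw (tens_scalar (in_crossed (K:=K) D) z)
    = tens_scalar (out_crossed (K:=K) D) ((tait_number G)%:R * z).
Proof. exact: (chi_cw_tait (@norm_hausdorff _ _) hbord hin hout). Qed.
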